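(* Let $s\ge 1$, $n_1,\dots,n_s\ge 2$, $N=\sum_{l=1}^s n_l$, and let $X=\mathbb{S}^{n_1-1}\times\dots\times\mathbb{S}^{n_s-1}\subset\mathbb{R}^N$ be the product of unit spheres. Write $x=(x_1,\dots,x_s)$ with $x_l=(x_{l1},\dots,x_{ln_l})$, let $\varphi_l=1-\|x_l\|^2$ for $l=1,\dots,s$, and let $\boldsymbol{\varphi}_s=(\varphi_1,\dots,\varphi_s)$. Let $f,h_1,\dots,h_m\in\mathbb{R}[x]$ and $b\in\mathbb{R}^m$. Assume that $h_1\equiv 1$, $b_1>0$, and that $b=(b_1,\dots,b_m)$ is in the relative interior of $$K=\Big\{\Big(\int_X h_i\,d\mu\Big)_{i=1,\dots,m}\ \Big|\ \mu\in\mathcal{M}_+(X)\Big\}.$$ Then, for all integers $t\ge t_{\min}$, the semidefinite program $$\sup_{\lambda\in\mathbb{R}^m}\Big\{\sum_{i=1}^m b_i\lambda_i\ :\ f-\sum_{i=1}^m\lambda_ih_i\in\Sigma[x]_{2t}+\langle\boldsymbol{\varphi}_s\rangle_{2t}\Big\}$$ attains its optimal value, i.e. the supremum is a maximum.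
   Context: $\mathcal{M}_+(X)$ is the set of finite nonnegative Borel measures supported on $X$; relative interior means interior within the affine hull. $\mathbb{R}[x]$ is the polynomial ring in the $N$ variables $x_{li}$. $\Sigma[x]_{2t}$ is the set of sums of squares of polynomials having degree at most $2t$, and $\langle\boldsymbol{\varphi}_s\rangle_{2t}=\{\sum_{l=1}^s k_l\varphi_l\mid k_l\in\mathbb{R}[x],\ \deg(k_l\varphi_l)\le 2t\}$. The integer $t_{\min}$ is the maximum of $1$ (which is $\lceil\deg(\varphi_l)/2\rceil$), $\lceil\deg(f)/2\rceil$ and $\lceil\deg(h_i)/2\rceil$, $i=1,\dots,m$. *)

(* Defs.v *)
From HB Require Import structures.
From mathcomp Require Import all_boot all_order all_algebra.
From mathcomp Require Import all_classical all_reals all_analysis.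
(* The notations of multinomials clash with those of mathcomp-analysis, hence
   the filtered import and the restatement of {mpoly R[n]} below. *)
From mathcomp Require Import -(notations) mpoly.

Set Implicit Arguments.
Unset Strict Implicit.
Unset Printing Implicit Defensive.

Import Order.TTheory GRing.Theory Num.Theory.
Import numFieldNormedType.Exports.

Local Open Scope classical_set_scope.
Local Open Scope ring_scope.

Notation "{ 'mpoly' R [ n ] }" := (mpoly n R)
  (at level 0, R at level 2, n at level 2, format "{ 'mpoly'  R [ n ] }").

Section RelativeInterior.
Context {R : realType} {V : normedModType R}.

Definition affine_hull (A : set V) : set V :=
  [set y | exists (k : nat) (a : 'I_k -> R) (p : 'I_k -> V),
     [/\ forall i, A (p i), \sum_i a i = 1 & y = \sum_i a i *: p i]].

Definition relative_interior (A : set V) : set V :=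
  [set y | A y /\ within (affine_hull A) (nbhs y) A].

End RelativeInterior.

Section Polynomials.
Context {R : realType} {N : nat}.
Implicit Types p : {mpoly R[N]}.

(* The zero polynomial gets degree 0, which is harmless as degrees are only
   compared with nonnegative bounds. *)
Definition mpdeg p : nat := (@mmeasure N R mdeg p).-1.

Definition sos_le (d : nat) : set {mpoly R[N]} :=
  [set p | (mpdeg p <= d)%N /\
           exists qs : seq {mpoly R[N]}, p = \sum_(q <- qs) q ^+ 2].

Definition truncated_ideal (s : nat) (phi : 'I_s -> {mpoly R[N]}) (d : nat) :
    set {mpoly R[N]} :=
  [set p | exists k : 'I_s -> {mpoly R[N]},
     (forall l, (mpdeg (k l * phi l)%R <= d)%N) /\ p = \sum_l k l * phi l].

End Polynomials.

Section ProductOfSpheres.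
Context {R : realType}.

(* The norm of 'rV[R]_n in the library is the max norm, so the Euclidean one is
   spelled out. *)
Definition unit_sphere (n : nat) : set 'rV[R]_n :=
  [set x : 'rV[R]_n | \sum_(i < n) x ord0 i ^+ 2 = 1].

Context (s : nat) (n : 'I_s -> nat).

(* The coordinate x_{li} of R^(n_1 + ... + n_s) has index tagnat.Rank l i, and
   submxrow x l is the block x_l. *)
Definition sphere_product : set 'rV[R]_(\sum_(l < s) n l) :=
  [set x : 'rV[R]_(\sum_(l < s) n l) | forall l, unit_sphere (submxrow x l)].

Definition sphere_poly (l : 'I_s) : {mpoly R[\sum_(l < s) n l]} :=
  1 - \sum_(i < n l) mpolyX R (mnm1 (tagnat.Rank l i)) ^+ 2.

End ProductOfSpheres.

Arguments unit_sphere {R} n.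
Arguments sphere_product {R s} n.
Arguments sphere_poly {R s} n l.

Notation borel_rV R N := (g_sigma_algebraType (@open 'rV[R]_N)).

Section MomentProblem.
Context {R : realType} {N m : nat}.

Definition mpeval (p : {mpoly R[N]}) (x : 'rV[R]_N) : R :=
  meval (x ord0) p.

Definition supported_on (X : set 'rV[R]_N)
    (mu : {finite_measure set (borel_rV R N) -> \bar R}) : Prop :=
  mu (~` X) = 0%E.

Definition moment_cone (X : set 'rV[R]_N) (h : 'I_m -> {mpoly R[N]}) :
    set 'rV[R]_m :=
  [set y : 'rV[R]_m | exists2 mu : {finite_measure set (borel_rV R N) -> \bar R},
     supported_on X mu &
     forall i, (\int[mu]_(x in X) (mpeval (h i) x)%:E = (y ord0 i)%:E)%E].

End MomentProblem.

Section SemidefiniteProgram.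
Context {R : realType} {N m s : nat}.
Variables (phi : 'I_s -> {mpoly R[N]}) (f : {mpoly R[N]}).
Variables (h : 'I_m -> {mpoly R[N]}) (b : 'rV[R]_m) (t : nat).

Definition sdp_feasible : set 'rV[R]_m :=
  [set lambda : 'rV[R]_m |
     [set p + q | p in sos_le (2 * t) &
                  q in truncated_ideal phi (2 * t)]
     (f - \sum_i lambda ord0 i *: h i)].

Definition sdp_objective (lambda : 'rV[R]_m) : R :=
  \sum_i b ord0 i * lambda ord0 i.

Definition sdp_value : \bar R :=
  ereal_sup [set (sdp_objective lambda)%:E | lambda in sdp_feasible].

End SemidefiniteProgram.

Definition t_min (R : realType) (N m : nat) (f : {mpoly R[N]})
    (h : 'I_m -> {mpoly R[N]}) : nat :=
  maxn 1 (maxn (uphalf (mpdeg f)) (\max_(i < m) uphalf (mpdeg (h i)))).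

(* Main.v *)
(** Feasibility and attainment rest on three facts about the sphere product
    X. First, 1 is an order unit of the truncated quadratic module, because
    1 - x^(2b) lies in it for every monomial x^b; so some lambda = (-c, 0,
    ..., 0) is feasible. Second, a polynomial of degree at most d vanishing
    on X lies in the ideal truncated at degree d; hence p is in the
    truncated module iff, as a function on X, it is a sum of D squares of
    combinations of the D monomials of degree at most t, and this condition
    is closed. Third, for x in X the moment vector h(x) is in K, so b + e (b
    - h(x)) is in K for some e > 0; pairing it with lambda bounds sum_i
    lambda_i h_i(x) from below on each superlevel set of the objective,
    while f(x) bounds it from above. Parametrising the lambdas by the values
    of sum_i lambda_i h_i at finitely many points, and the squares likewise,
    turns a superlevel set of the program into a compact set on which the
    continuous objective attains its maximum. *)
Require Import Defs.
From HB Require Import structures.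
From mathcomp Require Import all_boot all_order all_algebra.
From mathcomp Require Import all_classical all_reals all_analysis.
From mathcomp Require Import -(notations) mpoly.
From mathcomp Require Import measurable_realfun zify ring lra.

Set Implicit Arguments.
Unset Strict Implicit.
Unset Printing Implicit Defensive.

Import Order.TTheory GRing.Theory Num.Theory.
Import numFieldNormedType.Exports.

Local Open Scope classical_set_scope.
Local Open Scope ring_scope.

(** * Degree bounds *)

Section Degree.
Context {R : realType} {N : nat}.
Implicit Types (p q : {mpoly R[N]}) (d e : nat).

Lemma mpdeg_leP p d :
  reflect (forall m, m \in msupp p -> (mdeg m <= d)%N) (mpdeg p <= d)%N.
Proof.
rewrite /mpdeg; apply: (iffP idP) => [pd m mp|pd].
  rewrite -ltnS (leq_trans (mmeasure_mnm_lt mdeg mp))//.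
  by rewrite -add1n -leq_subLR subn1.
rewrite -subn1 leq_subLR add1n mmeasureE big_seq.
apply/bigmax_leqP_seq => m mp _.
exact: pd.
Qed.

(** [mmeasure] is one more than the degree, and 0 for the zero polynomial; the two bounds agree in
    both cases. *)
Lemma mpdeg_msize p d : (mmeasure mdeg p <= d.+1)%N = (mpdeg p <= d)%N.
Proof. by rewrite /mpdeg -subn1 leq_subLR add1n. Qed.

Lemma mpdeg_leW p d e : (d <= e)%N -> (mpdeg p <= d)%N -> (mpdeg p <= e)%N.
Proof. by move=> de /leq_trans; apply. Qed.

Lemma mpdeg0_le d : (mpdeg (0%R : {mpoly R[N]}) <= d)%N.
Proof. by rewrite -mpdeg_msize mmeasure0. Qed.

Lemma mpdeg1_le d : (mpdeg (1%R : {mpoly R[N]}) <= d)%N.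
Proof. by rewrite -mpdeg_msize mmeasure1. Qed.

Lemma mpdegX_le (m : multinom N) d : (mdeg m <= d)%N ->
  (mpdeg (mpolyX R m) <= d)%N.
Proof. by rewrite -mpdeg_msize mmeasureX. Qed.

Lemma mpdegD_le p q d : (mpdeg p <= d)%N -> (mpdeg q <= d)%N ->
  (mpdeg (p + q)%R <= d)%N.
Proof.
rewrite -!mpdeg_msize => pd qd; apply: leq_trans (mmeasureD_le _ _ _) _.
by rewrite geq_max pd qd.
Qed.

Lemma mpdegZ_le (c : R) p d : (mpdeg p <= d)%N -> (mpdeg (c *: p)%R <= d)%N.
Proof. by rewrite -!mpdeg_msize; apply: leq_trans; exact: mmeasureZ_le. Qed.

Lemma mpdegN_le p d : (mpdeg p <= d)%N -> (mpdeg (- p)%R <= d)%N.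
Proof. by rewrite -!mpdeg_msize mmeasureN. Qed.

Lemma mpdeg_sum_le (I : Type) (r : seq I) (P : pred I)
    (F : I -> {mpoly R[N]}) d :
  (forall i, P i -> (mpdeg (F i) <= d)%N) ->
  (mpdeg (\sum_(i <- r | P i) F i)%R <= d)%N.
Proof.
move=> Fd; apply: (big_ind (fun p => mpdeg p <= d)%N) => //.
  exact: mpdeg0_le.
by move=> p q; exact: mpdegD_le.
Qed.

Lemma mpdegM_le p q d e : (mpdeg p <= d)%N -> (mpdeg q <= e)%N ->
  (mpdeg (p * q)%R <= d + e)%N.
Proof.
move=> /mpdeg_leP pd /mpdeg_leP qe; apply/mpdeg_leP => m /msuppM_le /allpairsP.
move=> [[m1 m2] /= [/pd h1 /qe h2 ->]]; rewrite mdegD; exact: leq_add.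
Qed.

End Degree.

(** * Vanishing on grids and along coordinate lines *)

Section GridVanishing.
Context {R : realType} {N : nat}.
Implicit Types (p : {mpoly R[N]}) (v : 'I_N -> R).

Lemma mevalE_var p v i (c : R) :
  meval (fun j => if j == i then c else v j) p =
  \sum_(m <- msupp p)
     (mcoeff m p * \prod_(j < N | j != i) v j ^+ m j) * c ^+ m i.
Proof.
rewrite mevalE; apply: eq_bigr => m _; rewrite -mulrA; congr (_ * _).
rewrite (bigD1 i)//= eqxx mulrC; congr (_ * _).
by apply: eq_bigr => j /negbTE ->.
Qed.

(* The coefficients in the variables of [s] are extracted one variable at a
   time, the remaining variables being evaluated on the grid. *)
Lemma mpoly_eq0_grid p (a : nat -> R) : injective a ->
  (forall e : 'I_N -> nat, meval (a \o e) p = 0) -> p = 0.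
Proof.
move=> a_inj p0.
have key (s : seq 'I_N) : forall (k e : 'I_N -> nat),
    \sum_(m <- msupp p | all (fun i => m i == k i) s)
       mcoeff m p * \prod_(j < N | j \notin s) a (e j) ^+ m j = 0.
  elim: s => [|i s IH] k e.
    under eq_bigl do rewrite /=.
    by have := p0 e; rewrite mevalE.
  have [is_|is_] := boolP (i \in s).
    have [kk|kk] := pselect (forall m, all (fun j => m j == k j) s -> m i == k i).
      rewrite -[RHS](IH k e); apply: eq_big => [m|m _] /=.
        by case: (boolP (all _ s)) => [/kk ->|_]; rewrite ?andbF.
      congr (_ * _); apply: eq_bigl => j; rewrite inE negb_or.
      by case: eqP => // ->; rewrite is_.
    exfalso; apply: kk => m /allP; exact.
  (* [Q] frees the variable [i] and keeps the others on the grid; the induction hypothesis makes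
     every [a x] a root. *)
  pose Q : {poly R} := \sum_(m <- msupp p | all (fun j => m j == k j) s)
     (mcoeff m p * \prod_(j < N | j \notin i :: s) a (e j) ^+ m j) *: 'X^(m i).
  have Q0 : Q = 0.
    apply/eqP/negPn/negP => Qn0.
    suff : (size [seq a x | x <- iota 0 (size Q)] < size Q)%N.
      by rewrite size_map size_iota ltnn.
    apply: max_poly_roots => //; last by rewrite map_inj_uniq// iota_uniq.
    apply/allP => _ /mapP [x _ ->]; apply/rootP.
    rewrite /Q horner_sum -[RHS](IH k (fun j => if j == i then x else e j)).
    apply: eq_bigr => m _; rewrite hornerZ hornerXn -mulrA; congr (_ * _).
    rewrite [in RHS](bigD1 i)//= eqxx mulrC; congr (_ * _).
    apply: eq_big => [j|j]; first by rewrite inE negb_or andbC.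
    by rewrite inE negb_or => /andP[/negbTE ->].
  have /(congr1 (fun q : {poly R} => q`_(k i))) := Q0.
  rewrite coef0 /Q coef_sum => Qk; rewrite -[RHS]Qk /= big_mkcondl/=.
  apply: eq_bigr => m _; rewrite coefZ coefXn eq_sym.
  by case: eqP => _; rewrite ?mulr1 ?mulr0.
apply/mpolyP => m; rewrite mcoeff0.
(* Once all variables are extracted, only the coefficient at [m] is left. *)
have := key (enum 'I_N) (fun i => m i) (fun=> 0%N).
rewrite (eq_bigl (pred1 m)); last first.
  move=> m' /=; apply/allP/eqP => [mm|-> //].
  by apply/mnmP => i; apply/eqP/mm; rewrite mem_enum.
case: (boolP (m \in msupp p)) => mp; last by rewrite (memN_msupp_eq0 mp).
rewrite -big_filter filter_pred1_uniq ?msupp_uniq// big_seq1 big_pred0 ?mulr1//.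
by move=> j; rewrite mem_enum.
Qed.

(** Along the direction [i] the polynomial is [A + B * x], and two distinct zeros force
    [A = B = 0]. *)
Lemma meval_affine_var p (i : 'I_N) :
  (forall m : multinom N, m \in msupp p -> (m i <= 1)%N) ->
  forall v (c1 c2 c : R), c1 != c2 ->
  meval (fun j => if j == i then c1 else v j) p = 0 ->
  meval (fun j => if j == i then c2 else v j) p = 0 ->
  meval (fun j => if j == i then c else v j) p = 0.
Proof.
move=> p1 v c1 c2 c c12.
pose g (m : multinom N) := mcoeff m p * \prod_(j < N | j != i) v j ^+ m j.
have E x : meval (fun j => if j == i then x else v j) p =
  \sum_(m <- msupp p | m i == 0%N) g m +
  (\sum_(m <- msupp p | m i != 0%N) g m) * x.
  rewrite mevalE_var (bigID (fun m : multinom N => m i == 0%N))/=; congr (_ + _).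
    by apply: eq_bigr => m /eqP ->; rewrite mulr1.
  rewrite mulr_suml big_seq_cond [RHS]big_seq_cond.
  apply: eq_bigr => m /andP[/p1 m1 m0].
  by have -> : m i = 1%N by lia.
rewrite !E; set A := \sum_(m <- _ | _) _; set B := \sum_(m <- _ | _) _.
move=> h1 h2.
have B0 : B = 0.
  have : B * (c1 - c2) = 0 by rewrite mulrBr -[RHS]subr0 -{1}h1 -{1}h2; ring.
  by move/eqP; rewrite mulf_eq0 subr_eq0 (negbTE c12) orbF => /eqP.
by move: h1; rewrite B0 !mul0r.
Qed.

End GridVanishing.

(** * Closure properties of truncated ideals *)

Section TruncatedIdeal.
Context {R : realType} {N s : nat}.
Implicit Types (p q : {mpoly R[N]}) (phi : 'I_s -> {mpoly R[N]}) (d : nat).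

Lemma truncated_idealZ phi d (c : R) p :
  truncated_ideal phi d p -> truncated_ideal phi d (c *: p).
Proof.
move=> [k [kd ->]]; exists (fun l => c *: k l); split.
  by move=> l; rewrite -scalerAl; exact: mpdegZ_le.
by rewrite scaler_sumr; apply: eq_bigr => l _; rewrite scalerAl.
Qed.

Lemma truncated_idealN phi d p :
  truncated_ideal phi d p -> truncated_ideal phi d (- p).
Proof. by rewrite -scaleN1r; exact: truncated_idealZ. Qed.

Lemma truncated_idealD phi d p q : truncated_ideal phi d p ->
  truncated_ideal phi d q -> truncated_ideal phi d (p + q).
Proof.
move=> [k [kd ->]] [k' [kd' ->]]; exists (fun l => k l + k' l); split.
  by move=> l; rewrite mulrDl; exact: mpdegD_le.
by rewrite -big_split/=; apply: eq_bigr => l _; rewrite mulrDl.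
Qed.

Lemma truncated_ideal_mull phi d p l : (mpdeg (p * phi l)%R <= d)%N ->
  truncated_ideal phi d (p * phi l).
Proof.
move=> pd; exists (fun l' => if l' == l then p else 0); split.
  by move=> l'; case: eqP => [->//|_]; rewrite mul0r mpdeg0_le.
rewrite (bigD1 l)//= eqxx big1 ?addr0// => l' /negbTE ->.
by rewrite mul0r.
Qed.

Lemma truncated_ideal0 phi d : truncated_ideal phi d 0.
Proof.
exists (fun=> 0); split; first by move=> l; rewrite mul0r mpdeg0_le.
by rewrite big1// => l _; rewrite mul0r.
Qed.

End TruncatedIdeal.

(** * Reduction modulo the sphere equations and a truncated Nullstellensatz *)

Section SphereIdeal.
Context {R : realType} {s : nat} {n : 'I_s -> nat}.
Context (n_gt0 : forall l, (0 < n l)%N).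
Local Notation N := (\sum_(l < s) n l)%N.
Implicit Types (p q : {mpoly R[N]}) (d : nat) (v : 'I_N -> R).

Let z (l : 'I_s) : 'I_(n l) := Ordinal (n_gt0 l).
Let zi (l : 'I_s) : 'I_N := tagnat.Rank l (z l).

Lemma sphere_productE (x : 'rV[R]_N) : sphere_product n x <->
  forall l, \sum_(i < n l) x ord0 (tagnat.Rank l i) ^+ 2 = 1.
Proof.
have xE l : \sum_(i < n l) submxrow x l ord0 i ^+ 2 =
    \sum_(i < n l) x ord0 (tagnat.Rank l i) ^+ 2.
  by apply: eq_bigr => i _; rewrite /submxrow mxE.
by split=> xX l; have := xX l; rewrite /unit_sphere/= xE.
Qed.

Lemma Rank_eq_zi l (i : 'I_(n l)) l' :
  (tagnat.Rank l i == zi l') = (l == l') && (i == 0%N :> nat).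
Proof. by rewrite -val_eqE/= tagnat.eq_Rank. Qed.

Lemma meval_sphere_poly v l :
  meval v (sphere_poly n l) = 1 - \sum_(i < n l) v (tagnat.Rank l i) ^+ 2.
Proof.
rewrite /sphere_poly mevalB meval1; congr (_ - _).
rewrite raddf_sum/=; apply: eq_bigr => i _.
by rewrite expr2 mevalM mevalXU expr2.
Qed.

Lemma mpdeg_sphere_poly l : (mpdeg (@sphere_poly R s n l) <= 2)%N.
Proof.
apply: mpdegD_le; first exact: mpdeg1_le.
apply/mpdegN_le/mpdeg_sum_le => i _; rewrite expr2.
by apply: (@mpdegM_le _ _ _ _ 1 1); apply: mpdegX_le; rewrite mdeg1.
Qed.

(** Normal form modulo the sphere equations, which allow the square of the first coordinate of each
    block to be eliminated. *)
Definition z_reduced p :=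
  forall m, m \in msupp p -> forall l, (m (zi l) <= 1)%N.

Lemma z_reducedD p q : z_reduced p -> z_reduced q -> z_reduced (p + q).
Proof.
by move=> pr qr m /msuppD_le; rewrite mem_cat => /orP[/pr|/qr].
Qed.

Lemma z_reducedZ (c : R) p : z_reduced p -> z_reduced (c *: p).
Proof. by move=> pr m /msuppZ_le /pr. Qed.

(** Division with remainder in which the ideal part respects the degree bound [d]. *)
Definition sphere_reducible d p := exists q r,
  [/\ truncated_ideal (sphere_poly n) d q, z_reduced r & p = q + r].

Lemma sphere_reducibleD d p q : sphere_reducible d p ->
  sphere_reducible d q -> sphere_reducible d (p + q).
Proof.
move=> [p1 [p2 [ip rp ->]]] [q1 [q2 [iq rq ->]]].
exists (p1 + q1), (p2 + q2); split.
- exact: truncated_idealD.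
- exact: z_reducedD.
by rewrite addrACA.
Qed.

Lemma sphere_reducibleZ d (c : R) p : sphere_reducible d p ->
  sphere_reducible d (c *: p).
Proof.
move=> [p1 [p2 [ip rp ->]]]; exists (c *: p1), (c *: p2).
by split; [exact: truncated_idealZ|exact: z_reducedZ|rewrite scalerDr].
Qed.

Lemma sphere_reducible_sum d (I : Type) (r : seq I) (P : pred I)
    (F : I -> {mpoly R[N]}) :
  (forall i, P i -> sphere_reducible d (F i)) ->
  sphere_reducible d (\sum_(i <- r | P i) F i).
Proof.
move=> Fd; apply: (big_ind (sphere_reducible d)) => //.
  exists 0, 0; split; [exact: truncated_ideal0| |by rewrite addr0].
  by move=> m; rewrite msupp0.
by move=> p q; exact: sphere_reducibleD.
Qed.

(** Replacing a factor [x_(l, 0)^2] by [1 - phi_l] minus the other squares of the block lowers the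
    total exponent of the first coordinates, on which the induction runs, and never raises the
    degree. *)
Lemma sphere_reducibleX d (m : multinom N) : (mdeg m <= d)%N ->
  sphere_reducible d (mpolyX R m).
Proof.
have [k] := ubnP (\sum_l m (zi l))%N.
elim: k m => // k IH m mk md.
have [m1|] := pselect (forall l, m (zi l) <= 1)%N.
  exists 0, (mpolyX R m); split; [exact: truncated_ideal0| |by rewrite add0r].
  by move=> m'; rewrite msuppX inE => /eqP ->.
move=> /existsNP[l /negP]; rewrite -ltnNge => ml.
pose sq (i : 'I_N) : multinom N := mnm_add (mnm1 i) (mnm1 i).
pose m' : multinom N := mnm_sub m (sq (zi l)).
have mE : m = mnm_add m' (sq (zi l)).
  apply/mnmP => i; rewrite /m' /sq !(mnmDE, mnmBE, mnm1E).
  by case: eqP => [<-|_] /=; [rewrite subnK|rewrite !addn0 subn0].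
have mdE : mdeg m = (mdeg m' + 2)%N by rewrite {1}mE !mdegD !mdeg1.
have sqE i : mpolyX R (sq i) = mpolyX R (mnm1 i) ^+ 2.
  by rewrite mpolyXD expr2.
have zcount (m0 : multinom N) : (forall l', m0 (zi l') = m' (zi l')) ->
    (\sum_l' m0 (zi l') < k)%N.
  move=> m0E; rewrite -ltnS; apply: leq_trans mk; rewrite ltnS.
  rewrite (bigD1 l)//= [leqRHS](bigD1 l)//= -addSn leq_add//.
    by rewrite m0E mE mnmDE mnmDE mnm1E eqxx -[X in (X < _)%N]addn0 ltn_add2l.
  by apply: leq_sum => l' _; rewrite m0E mE mnmDE leq_addr.
have XE : mpolyX R m = (mpolyX R m' - mpolyX R m' * sphere_poly n l) -
    \sum_(i < n l | i != z l) mpolyX R (mnm_add m' (sq (tagnat.Rank l i))).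
  rewrite {1}mE mpolyXD sqE /sphere_poly (bigD1 (z l))//= -/(zi l).
  under [X in _ = _ - X]eq_bigr do rewrite mpolyXD sqE.
  by rewrite -mulr_sumr; ring.
rewrite XE; apply: sphere_reducibleD; last first.
  rewrite -scaleN1r; apply: sphere_reducibleZ; apply: sphere_reducible_sum.
  move=> i iz; apply: IH; last by rewrite !mdegD !mdeg1; lia.
  apply: zcount => l'; rewrite !mnmDE mnm1E Rank_eq_zi.
  have /negbTE -> : (i != 0%N :> nat) by rewrite -val_eqE in iz.
  by rewrite andbF !addn0.
apply: sphere_reducibleD; first by apply: IH; [exact: zcount|lia].
exists (- (mpolyX R m' * sphere_poly n l)), 0; split; last by rewrite addr0.
  apply/truncated_idealN/truncated_ideal_mull.
  apply: (mpdeg_leW _ (mpdegM_le (mpdegX_le (leqnn _)) (mpdeg_sphere_poly _))).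
  by rewrite -mdE.
by move=> m0; rewrite msupp0.
Qed.


Lemma sphere_reducible_deg d p : (mpdeg p <= d)%N -> sphere_reducible d p.
Proof.
move=> /mpdeg_leP pd; rewrite (mpolyE p) big_seq.
apply: sphere_reducible_sum => m /pd md.
exact/sphere_reducibleZ/sphere_reducibleX.
Qed.

(* A reduced polynomial is affine in each variable [x_(l, 0)], in which it
   vanishes at the two points of the sphere above a small [(x_(l, i))_(i > 0)];
   so the sphere constraints can be dropped one at a time. *)
Lemma z_reduced_eq0 p : z_reduced p ->
  (forall v, (forall l, \sum_(i < n l) v (tagnat.Rank l i) ^+ 2 = 1) ->
     meval v p = 0) ->
  p = 0.
Proof.
move=> pr pX.
pose rest v l := \sum_(i < n l | i != z l) v (tagnat.Rank l i) ^+ 2.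
have sumE v l : \sum_(i < n l) v (tagnat.Rank l i) ^+ 2 =
    v (zi l) ^+ 2 + rest v l.
  by rewrite (bigD1 (z l)).
have upd_rest v l c l' :
    rest (fun j => if j == zi l then c else v j) l' = rest v l'.
  apply: eq_bigr => i iz; rewrite Rank_eq_zi.
  have /negbTE -> : (i != 0%N :> nat) by rewrite -val_eqE in iz.
  by rewrite andbF.
have zi_inj l l' : (zi l == zi l') = (l == l') by rewrite Rank_eq_zi eqxx andbT.
(* Only the blocks from [k] on must lie on their spheres; earlier blocks keep just the inequality
   [rest v l < 1]. *)
have drop k : forall v, (forall l, rest v l < 1) ->
    (forall l : 'I_s, (k <= l)%N -> v (zi l) ^+ 2 + rest v l = 1) ->
    meval v p = 0.
  elim: k => [|k IH] v v1 vX.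
    by apply: pX => l; rewrite sumE vX.
  have [ks|sk] := ltnP k s; last first.
    apply: IH => // l kl; have := ltn_ord l; lia.
  (* The strict inequality makes [c] nonzero, so [c] and [- c] are two distinct zeros in the
     coordinate [zi l]. *)
  pose l := Ordinal ks; pose c := Num.sqrt (1 - rest v l).
  have c_gt0 : 0 < c by rewrite sqrtr_gt0 subr_gt0.
  have c2 : c ^+ 2 = 1 - rest v l by rewrite sqr_sqrtr// subr_ge0 ltW.
  have vE : v = (fun j => if j == zi l then v (zi l) else v j).
    by apply/funext => j; case: eqP => [->|].
  have upd0 a : a ^+ 2 = 1 - rest v l ->
      meval (fun j => if j == zi l then a else v j) p = 0.
    move=> a2; apply: IH => [l'|l' kl']; rewrite upd_rest// zi_inj.
    have [->|ll'] := eqVneq l' l; first by rewrite a2 subrK.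
    apply: vX; move: ll'; rewrite -val_eqE/=; lia.
  rewrite vE; apply: (@meval_affine_var _ _ p (zi l) _ v c (- c)).
  - by move=> m mp; exact: pr.
  - by rewrite -subr_eq0 opprK; apply: lt0r_neq0; exact: addr_gt0.
  - exact: upd0.
  - by apply: upd0; rewrite sqrrN.
(* All grid values are at most [1 / (N + 1)], hence the squares of one block sum to at most
   [n l / (N + 1) < 1]. *)
apply: (@mpoly_eq0_grid _ _ p (fun k => (k + N.+1)%:R^-1)).
  by move=> i j /invr_inj /eqP; rewrite eqr_nat eqn_add2r => /eqP.
move=> e; apply: (drop s) => l; last by rewrite leqNgt ltn_ord.
have N0 : 0 < N.+1%:R :> R by rewrite ltr0n.
apply: (@le_lt_trans _ _ (\sum_(i < n l) N.+1%:R^-1)).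
  rewrite /rest big_mkcond/=; apply: ler_sum => i _.
  case: ifP => _; last by rewrite invr_ge0 ltW.
  set a : R := _ ^-1.
  have a1 : a <= N.+1%:R^-1.
    by rewrite lef_pV2 ?posrE ?ltr0n ?ler_nat ?addnS// ltnS leq_addl.
  have a0 : 0 <= a by rewrite invr_ge0 ler0n.
  apply: (le_trans _ a1); rewrite expr2 ler_piMr//; apply: (le_trans a1).
  by rewrite invf_le1// ler1n.
rewrite sumr_const card_ord -[_ *+ _]mulr_natr mulrC ltr_pdivrMr// mul1r.
rewrite ltr_nat ltnS.
by rewrite (bigD1 l)//= leq_addr.
Qed.

(** The reduced remainder of [p] also vanishes on the sphere product, so it is 0 and [p] equals its
    ideal part. *)
Lemma sphere_nullstellensatz d p : (mpdeg p <= d)%N ->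
  (forall x : 'rV[R]_N, sphere_product n x -> mpeval p x = 0) ->
  truncated_ideal (sphere_poly n) d p.
Proof.
move=> pd pX; have [q [r [iq rr pE]]] := sphere_reducible_deg pd.
suff r0 : r = 0 by rewrite pE r0 addr0.
apply: z_reduced_eq0 => // v vX.
have vE : (\row_i v i) ord0 = v by apply/funext => i; rewrite mxE.
have q0 : meval v q = 0.
  have [k [_ ->]] := iq; rewrite raddf_sum; apply: big1 => l _ /=.
  by rewrite mevalM meval_sphere_poly vX subrr mulr0.
have := pX (\row_i v i); rewrite /mpeval pE vE mevalD q0 add0r.
apply; apply/sphere_productE => l.
by under eq_bigr do rewrite mxE.
Qed.

End SphereIdeal.

(** * Closure properties of the truncated quadratic module *)

Section TruncatedModule.
Context {R : realType} {N s : nat} (phi : 'I_s -> {mpoly R[N]}).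
Implicit Types (p q : {mpoly R[N]}) (d : nat).

Definition truncated_module d : set {mpoly R[N]} :=
  [set p + q | p in sos_le d & q in truncated_ideal phi d].

Lemma sos_le0 d : sos_le d (0 : {mpoly R[N]}).
Proof. by split; [exact: mpdeg0_le|exists [::]; rewrite big_nil]. Qed.

Lemma sos_leD d p q : sos_le d p -> sos_le d q -> sos_le d (p + q).
Proof.
move=> [pd [ps pE]] [qd [qs qE]]; split; first exact: mpdegD_le.
by exists (ps ++ qs); rewrite big_cat/= -pE -qE.
Qed.

Lemma sos_leZ d (c : R) p : 0 <= c -> sos_le d p -> sos_le d (c *: p).
Proof.
move=> c0 [pd [ps pE]]; split; first exact: mpdegZ_le.
exists [seq Num.sqrt c *: q | q <- ps]; rewrite pE big_map scaler_sumr.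
by apply: eq_bigr => q _; rewrite exprZn sqr_sqrtr.
Qed.

Lemma sos_le_sqr d e q : (mpdeg q <= e)%N -> (2 * e <= d)%N -> sos_le d (q ^+ 2).
Proof.
move=> qe ed; split; last by exists [:: q]; rewrite big_seq1.
by apply: (mpdeg_leW ed); rewrite mul2n -addnn expr2; exact: mpdegM_le.
Qed.

Lemma truncated_moduleD d p q : truncated_module d p ->
  truncated_module d q -> truncated_module d (p + q).
Proof.
move=> [p1 ps [p2 pi <-]] [q1 qs [q2 qi <-]].
exists (p1 + q1); first exact: sos_leD.
by exists (p2 + q2); [exact: truncated_idealD|rewrite addrACA].
Qed.

Lemma truncated_moduleZ d (c : R) p : 0 <= c -> truncated_module d p ->
  truncated_module d (c *: p).
Proof.
move=> c0 [p1 ps [p2 pi <-]]; exists (c *: p1); first exact: sos_leZ.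
by exists (c *: p2); [exact: truncated_idealZ|rewrite scalerDr].
Qed.

Lemma sos_truncated_module d p : sos_le d p -> truncated_module d p.
Proof.
by move=> pd; exists p => //; exists 0; [exact: truncated_ideal0|rewrite addr0].
Qed.

Lemma ideal_truncated_module d p :
  truncated_ideal phi d p -> truncated_module d p.
Proof. by move=> pd; exists 0; [exact: sos_le0|exists p => //; rewrite add0r]. Qed.

Lemma truncated_module_sum d (I : Type) (r : seq I) (P : pred I)
    (F : I -> {mpoly R[N]}) :
  (forall i, P i -> truncated_module d (F i)) ->
  truncated_module d (\sum_(i <- r | P i) F i).
Proof.
move=> Fd; apply: (big_ind (truncated_module d)) => //.
  exact/sos_truncated_module/sos_le0.
by move=> p q; exact: truncated_moduleD.
Qed.

End TruncatedModule.

(** * The constant 1 as an order unit *)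

Lemma mnm_split N (m : multinom N) k : (k <= mdeg m)%N ->
  exists b b' : multinom N, m = mnm_add b b' /\ mdeg b = k.
Proof.
elim: k => [|k IH] km; first by exists mnm0, m; rewrite add0m mdeg0.
have [b [b' [mE bk]]] := IH (ltnW km).
have [i b'i] : exists i, b' i != 0%N.
  apply/existsP; rewrite -negb_forall; apply/negP => /forallP b'0.
  suff b'E : b' = mnm0 by move: km; rewrite mE b'E addm0 bk ltnn.
  by apply/mnmP => i; rewrite mnm0E; apply/eqP.
exists (mnm_add b (mnm1 i)), (mnm_sub b' (mnm1 i)).
split; last by rewrite mdegD mdeg1 bk addn1.
rewrite mE -addmA [mnm_add (mnm1 i) _]addmC submK//.
by rewrite lep1mP.
Qed.

Section SphereOrderUnit.
Context {R : realType} {s : nat} {n : 'I_s -> nat}.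
Local Notation N := (\sum_(l < s) n l)%N.
Implicit Types (f : {mpoly R[N]}) (b m : multinom N) (d t : nat).

(** Induction on the degree: if [x^b = Y * x_i] with [x_i] in block [l], then [1 - x^(2b)] is
    [1 - Y^2], plus [Y^2 * phi_l], plus the squares of [Y] times the other coordinates of the
    block. *)
Lemma sphere_module_monomial_sqr d b : (2 * mdeg b <= d)%N ->
  truncated_module (sphere_poly n) d (1 - mpolyX R b ^+ 2).
Proof.
have [k] := ubnP (mdeg b); elim: k b => // k IH b bk bd.
have [b0|bn0] := eqVneq (mdeg b) 0%N.
  have -> : b = mnm0 by apply/eqP; rewrite -mdeg_eq0 b0.
  rewrite mpolyX0 expr1n subrr; exact/sos_truncated_module/sos_le0.
have [u [b' [bE u1]]] := @mnm_split _ b 1 ltac:(by rewrite lt0n).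
have /eqP/mdeg1P[i /eqP uE] := u1.
have b'E : (mdeg b = (mdeg b').+1)%N by rewrite bE mdegD u1 add1n.
set l := tagnat.sig1 i; set j : 'I_(n l) := tagnat.sig2 i.
have iE : i = tagnat.Rank l j by rewrite tagnat.sig2K.
set Y := mpolyX R b'.
have -> : 1 - mpolyX R b ^+ 2 = (1 - Y ^+ 2) + (Y ^+ 2 * sphere_poly n l +
   \sum_(j' < n l | j' != j) (Y * mpolyX R (mnm1 (tagnat.Rank l j'))) ^+ 2).
  rewrite bE mpolyXD uE -/Y /sphere_poly (bigD1 j)//= -iE.
  under [X in _ = _ + (_ + X)]eq_bigr do rewrite exprMn.
  by rewrite -mulr_sumr; ring.
have [e eb'] : {e | mdeg b' = e} by exists (mdeg b').
rewrite b'E eb' in bk bd.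
have Yd : (mpdeg Y <= e)%N by apply: mpdegX_le; rewrite eb'.
apply: truncated_moduleD; first by apply: IH; rewrite eb'; lia.
apply: truncated_moduleD.
  apply/ideal_truncated_module/truncated_ideal_mull.
  apply: (@mpdeg_leW _ _ _ ((e + e) + 2)); first by lia.
  apply: mpdegM_le (mpdeg_sphere_poly l).
  by rewrite expr2; exact: mpdegM_le.
apply: truncated_module_sum => j' _.
apply/sos_truncated_module/(@sos_le_sqr _ _ _ e.+1) => //.
by rewrite -addn1; apply: mpdegM_le => //; apply: mpdegX_le; rewrite mdeg1.
Qed.

(** With [x^m = Y * Z], the polynomial is [|c| / 2] times
    [(Y + sg c * Z)^2 + (1 - Y^2) + (1 - Z^2)]. *)
Lemma sphere_module_monomial t m (c : R) : (mdeg m <= 2 * t)%N ->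
  truncated_module (sphere_poly n) (2 * t) (c *: mpolyX R m + `|c| *: 1).
Proof.
move=> mt; have [c0|cn0] := eqVneq c 0.
  by rewrite c0 normr0 !scale0r addr0; exact/sos_truncated_module/sos_le0.
(* The first factor takes as much degree as [t] allows, which leaves at most [t] for the second. *)
have [b [b' [mE bm]]] := @mnm_split _ m (minn t (mdeg m)) (geq_minr _ _).
have bt : (mdeg b <= t)%N by rewrite bm geq_minl.
have b't : (mdeg b' <= t)%N.
  have : (mdeg b + mdeg b')%N = mdeg m by rewrite mE mdegD.
  by move: mt; rewrite bm; move: (mdeg m) (mdeg b') => x y; lia.
set Y := mpolyX R b; set Z := mpolyX R b'.
have cE : c = `|c| * Num.sg c by rewrite mulrC -numEsg.
have sg2 : Num.sg c ^+ 2 = 1 by rewrite sqr_sg cn0.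
have -> : c *: mpolyX R m + `|c| *: 1 = (`|c| / 2) *:
    ((Y + Num.sg c *: Z) ^+ 2 + (1 - Y ^+ 2) + (1 - Z ^+ 2)).
  have -> : (Y + Num.sg c *: Z) ^+ 2 + (1 - Y ^+ 2) + (1 - Z ^+ 2) =
    2 *: (Num.sg c *: (Y * Z) + 1).
    rewrite sqrrD exprZn sg2 scale1r -scalerAr !scaler_nat; ring.
  rewrite scalerA divfK ?pnatr_eq0// scalerDr scalerA -cE -mpolyXD -mE//.
apply: truncated_moduleZ; first by rewrite divr_ge0.
apply: truncated_moduleD; last by apply: sphere_module_monomial_sqr; lia.
apply: truncated_moduleD; last by apply: sphere_module_monomial_sqr; lia.
apply/sos_truncated_module/(@sos_le_sqr _ _ _ t) => //.
apply: mpdegD_le; first exact: mpdegX_le.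
exact/mpdegZ_le/mpdegX_le.
Qed.

(** The monomial bounds add up, so the sum of the absolute values of the coefficients serves as
    [c]. *)
Lemma sphere_module_order_unit t f : (mpdeg f <= 2 * t)%N ->
  exists c : R, truncated_module (sphere_poly n) (2 * t) (f + c *: 1).
Proof.
move=> /mpdeg_leP ft; exists (\sum_(m <- msupp f) `|mcoeff m f|).
rewrite {1}(mpolyE f) scaler_suml -big_split/= [X in truncated_module _ _ X]big_seq.
by apply: truncated_module_sum => m /ft; exact: sphere_module_monomial.
Qed.

End SphereOrderUnit.

(** * Degrees of the summands in a sum of squares *)

Section SumsOfSquaresDegree.
Context {R : realType} {N : nat}.

(* The leading coefficients of the squares are positive, so the largest leading
   monomial does not cancel. *)
Lemma sum_sqr_deg (qs : seq {mpoly R[N]}) d :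
  (mpdeg (\sum_(q <- qs) q ^+ 2)%R <= 2 * d)%N ->
  forall q, q \in qs -> (mpdeg q <= d)%N.
Proof.
move=> /mpdeg_leP qsd q qqs; rewrite leqNgt; apply/negP => dq.
have [q0 q0qs leM] : exists2 q0, q0 \in qs &
    forall q', q' \in qs -> (mlead q' <= mlead q0)%O.
  have /tnthP[i _] : q \in in_tuple qs by [].
  case: (@arg_maxP _ _ _ i xpredT (fun i => mlead (tnth (in_tuple qs) i)) isT).
  move=> j _ jmax; exists (tnth (in_tuple qs) j); first exact: mem_tnth.
  by move=> q' q'qs; have /tnthP[k ->] : q' \in in_tuple qs by []; exact: jmax.
pose M := mlead q0.
have degM : (d < mdeg M)%N.
  apply: leq_trans (lemc_mdeg (leM _ qqs)).
  have qn0 : q != 0.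
    by apply/eqP => q00; move: dq; rewrite q00 ltnNge mpdeg0_le.
  by move: dq; rewrite /mpdeg -(mlead_deg qn0).
suff : mnm_add M M \in msupp (\sum_(q <- qs) q ^+ 2).
  move=> /qsd; rewrite mdegD; lia.
have coefM q' : q' \in qs -> mcoeff (mnm_add M M) (q' ^+ 2) = mcoeff M q' ^+ 2.
  by move=> /leM q'M; rewrite expr2 mleadcMW.
rewrite mcoeff_msupp raddf_sum/= big_seq.
under eq_bigr => q' q'qs do rewrite coefM//.
rewrite -big_seq (big_rem _ q0qs)/=; apply: lt0r_neq0.
apply: ltr_pwDl; last by apply: sumr_ge0 => i _; exact: sqr_ge0.
rewrite lt0r sqr_ge0 andbT sqrf_eq0 mleadc_eq0.
apply/eqP => q00; move: degM; rewrite /M q00 mlead0 mdeg0; lia.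
Qed.

End SumsOfSquaresDegree.

(** * Bounding the number of squares *)

Section GramReduction.
Context {R : realType}.

(* One Gram-Schmidt step: split off the first column [c] of [C] and project the
   other columns on its orthogonal; if [c = 0], then [S = 0] and [S^-1 = 0]. *)
Lemma gram_row_reduction K D (C : 'M[R]_(K, D)) :
  exists A : 'M[R]_D, A^T *m A = C^T *m C.
Proof.
elim: D C => [|D IH] C; first by exists 0; rewrite (flatmx0 (_ *m _)) [RHS]flatmx0.
move: C; rewrite -[D.+1]/(1 + D)%N => C.
pose c : 'M[R]_(K, 1) := lsubmx C.
pose C1 : 'M[R]_(K, D) := rsubmx C.
have CE : C = row_mx c C1 by rewrite hsubmxK.
pose S : R := (c^T *m c) 0 0.
have SE : c^T *m c = S%:M by rewrite [LHS]mx11_scalar.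
have SS : S = \sum_i c i 0 ^+ 2.
  by rewrite /S mxE; apply: eq_bigr => i _; rewrite mxE expr2.
have S_ge0 : 0 <= S by rewrite SS; apply: sumr_ge0 => i _; exact: sqr_ge0.
pose r := c^T *m C1.
have [A1 A1E] := IH (C1 - S^-1 *: (c *m r)).
(* A Cholesky factor: the first block row is [sqrt S] and [r / sqrt S], and [A1] handles the
   projected columns. *)
exists (block_mx (Num.sqrt S)%:M ((Num.sqrt S)^-1 *: r) 0 A1).
rewrite CE tr_row_mx mul_col_row tr_block_mx mulmx_block.
(* As [S] is a sum of squares, [S = 0] forces [c = 0] and [r = 0], so the default inverse of 0 is
   harmless. *)
have rS : S * (S^-1)  *: r = r.
  have [S0|Sn0] := eqVneq S 0; last by rewrite divff// scale1r.
  rewrite S0 mul0r scale0r /r; suff -> : c = 0 by rewrite trmx0 mul0mx.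
  apply/matrixP => i j; rewrite ord1; rewrite SS in S0.
  have /(_ i isT)/eqP := psumr_eq0P (fun k _ => sqr_ge0 (c k 0)) S0.
  by rewrite sqrf_eq0 => /eqP ->; rewrite mxE.
have sS : (Num.sqrt S) ^+ 2 = S by rewrite sqr_sqrtr.
have sr : Num.sqrt S * (Num.sqrt S)^-1 *: r = r.
  have [S0|Sn0] := eqVneq S 0; first by rewrite S0 sqrtr0 mul0r -{2}rS S0 mul0r.
  by rewrite divff ?scale1r// sqrtr_eq0 -ltNge lt0r Sn0.
congr block_mx.
- by rewrite tr_scalar_mx -scalar_mxM trmx0 mul0mx addr0 -expr2 sS -SE.
- by rewrite tr_scalar_mx mul_scalar_mx scalerA sr trmx0 mul0mx addr0.
- rewrite !linearZ/= mul_mx_scalar scalerA mulmx0 addr0 -linearZ/= sr.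
  by rewrite trmx_mul trmxK.
- rewrite A1E [(_ *: r)^T]linearZ/= -scalemxAl -scalemxAr scalerA -expr2 exprVn sS.
  have rT : r^T = C1^T *m c by rewrite trmx_mul trmxK.
  rewrite [(C1 - _)^T]linearB/= [(S^-1 *: (c *m r))^T]linearZ/= (trmx_mul c r).
  rewrite mulmxBl !mulmxBr.
  rewrite -!scalemxAl -!scalemxAr (mulmxA C1^T) -rT -(mulmxA _ c^T C1) -/r.
  rewrite -(mulmxA _ c^T) (mulmxA c^T) SE mul_scalar_mx.
  by rewrite -scalemxAr scalerA [S^-1 * S]mulrC scalemxAr rS subrr subr0 addrC
    subrK.
Qed.

(** The sum of squares depends on [C] only through the Gram matrix [C^T *m C], so [D] squares
    suffice. *)
Lemma sum_sqr_row_reduction (A : comAlgType R) K D (g : 'I_D -> A)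
    (C : 'M[R]_(K, D)) :
  exists B : 'M[R]_D, \sum_i (\sum_j C i j *: g j) ^+ 2 =
                      \sum_i (\sum_j B i j *: g j) ^+ 2.
Proof.
have gram L (B : 'M[R]_(L, D)) : \sum_i (\sum_j B i j *: g j) ^+ 2 =
    \sum_j \sum_k (B^T *m B) j k *: (g j * g k).
  under eq_bigr => i _.
    rewrite expr2 mulr_suml.
    under eq_bigr => j _ do rewrite mulr_sumr.
    over.
  rewrite exchange_big/=; apply: eq_bigr => j _.
  rewrite exchange_big/=; apply: eq_bigr => k _.
  rewrite mxE scaler_suml; apply: eq_bigr => i _.
  by rewrite mxE -scalerAl -scalerAr scalerA.
have [B BE] := gram_row_reduction C.
by exists B; rewrite !gram BE.
Qed.

End GramReduction.

(** * Gram form in the monomials of bounded degree *)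

Section BoundedMonomials.
Context {R : realType} {N : nat} (t : nat).
Implicit Types p : {mpoly R[N]}.

(** [bmultinom] bounds the degree strictly, so [t.+1] gives the exponents of degree at most [t]. *)
Definition nmonomials := #|{: bmultinom N t.+1}|.

Definition mexponent (i : 'I_nmonomials) : multinom N :=
  bmnm (enum_val i : bmultinom N t.+1).

Definition monomial (i : 'I_nmonomials) : {mpoly R[N]} :=
  mpolyX R (mexponent i).

Lemma mpdeg_monomial i : (mpdeg (monomial i) <= t)%N.
Proof. by apply: mpdegX_le; rewrite -ltnS bmdeg. Qed.

Lemma monomial_expansion p : (mpdeg p <= t)%N ->
  p = \sum_i mcoeff (mexponent i) p *: monomial i.
Proof.
rewrite -mpdeg_msize => pt; rewrite {1}(mpolywE pt).
by rewrite (reindex_onto enum_val enum_rank)//= => [|i _]; rewrite ?enum_rankK//;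
  apply: eq_bigl => i; rewrite enum_valK eqxx.
Qed.

(** Each squared polynomial has degree at most [t], hence is a combination of the monomials; row
    reduction then makes the number of squares independent of [p]. *)
Lemma sos_le_gram p : sos_le (2 * t) p ->
  exists A : 'M[R]_nmonomials, p = \sum_i (\sum_j A i j *: monomial j) ^+ 2.
Proof.
move=> [pt [qs pE]].
have qst q : q \in qs -> (mpdeg q <= t)%N.
  by apply: sum_sqr_deg; rewrite -pE.
have [A AE] := sum_sqr_row_reduction monomial
  (\matrix_(i < size qs, j < nmonomials)
     mcoeff (mexponent j) (tnth (in_tuple qs) i)).
exists A; rewrite -AE pE (big_tnth _ _ qs)/=; apply: eq_bigr => i _.
rewrite {1}(monomial_expansion (qst _ (mem_tnth i (in_tuple qs)))).
by congr (_ ^+ 2); apply: eq_bigr => j _; rewrite mxE.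
Qed.

End BoundedMonomials.

(* The points are chosen so that the rows [(g i (p j))_i] span all the rows
   [(g i x)_i]. *)
Lemma finite_interpolation (R : fieldType) (T : Type) (X : set T) D
    (g : 'I_D -> T -> R) :
  exists k (p : 'I_k -> T) (P : 'I_k -> 'I_D -> R), (forall j, X (p j)) /\
  forall (c : 'I_D -> R) x, X x ->
    \sum_i (\sum_j (\sum_i' c i' * g i' (p j)) * P j i) * g i x =
    \sum_i c i * g i x.
Proof.
pose M k (p : 'I_k -> T) : 'M[R]_(k, D) := \matrix_(j, i) g i (p j).
pose ranks : pred nat := fun r => `[< exists k (p : 'I_k -> T),
  (forall j, X (p j)) /\ \rank (M k p) = r >].
have ranks0 : exists r, ranks r.
  pose p (j : 'I_0) : T := False_rect T (notF (ltn_ord j)).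
  by exists (\rank (M 0%N p)); apply/asboolP; exists 0%N, p; split=> // -[].
have ranksD r : ranks r -> (r <= D)%N.
  by move=> /asboolP[k [p [_ <-]]]; exact: rank_leq_col.
case: (ex_maxnP ranks0 ranksD) => r /asboolP[k [p [pX pr]]] rmax.
pose v x : 'rV[R]_D := \row_i g i x.
(* Adjoining [x] cannot raise the maximal rank, so its row is already in the row space. *)
have vM x : X x -> (v x <= M k p)%MS.
  move=> xX; pose p' (j : 'I_(k + 1)) :=
    match fintype.split j with inl j' => p j' | inr _ => x end.
  have p'X j : X (p' j) by rewrite /p'; case: fintype.split.
  have p'M : M _ p' = col_mx (M k p) (v x).
    apply/matrixP => j i; rewrite /p' !mxE.
    by case: fintype.splitP => j' _; rewrite !mxE.
  have /rmax : ranks (\rank (M _ p')) by apply/asboolP; exists (k + 1)%N, p'.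
  rewrite -pr p'M -addsmxE => rk.
  have [rk' rkE] := mxrank_leqif_sup (addsmxSl (M k p) (v x)).
  have : \rank (M k p) == \rank (M k p + v x)%MS by rewrite eqn_leq rk' rk.
  by rewrite rkE addsmx_sub => /andP[_].
(* The pseudo-inverse turns the values at the points into coefficients of the same function on [X],
   possibly different from [c]. *)
exists k, p, (fun j i => pinvmx (M k p) i j); split=> // c x xX.
have /submxP[w vw] := vM x xX.
pose c' : 'rV[R]_D := \row_i c i.
have cE (d : 'rV[R]_D) : \sum_i d 0 i * g i x = (d *m (v x)^T) 0 0.
  by rewrite mxE; apply: eq_bigr => i _; rewrite !mxE.
transitivity ((c' *m (M k p)^T *m (pinvmx (M k p))^T *m (v x)^T) 0 0).
  rewrite -cE; apply: eq_bigr => i _; congr (_ * _).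
  rewrite mxE; apply: eq_bigr => j _; rewrite [X in _ = _ * X]mxE; congr (_ * _).
  by rewrite mxE; apply: eq_bigr => i' _; rewrite !mxE.
transitivity ((c' *m (v x)^T) 0 0); last first.
  by rewrite -cE; apply: eq_bigr => i _; rewrite mxE.
have MT : (M k p)^T *m (pinvmx (M k p))^T *m (M k p)^T = (M k p)^T.
  by rewrite -!trmx_mul mulmxA mulmxKpV.
by rewrite vw (trmx_mul w) -[in RHS]MT !mulmxA.
Qed.

(** * Moment cones and their relative interior *)

Section Moments.
Context {R : realType} {N : nat}.
Implicit Types (p : {mpoly R[N]}) (X : set 'rV[R]_N).

Lemma measurable_coordinate (i : 'I_N) :
  measurable_fun setT (fun x : borel_rV R N => x ord0 i).
Proof.
apply: (measurability _ (RGenOpens.measurableE R)).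
move=> _ [_ [a [b ->] <-]]; rewrite setTI; apply: sub_sigma_algebra.
have /continuousP := @coord_continuous R 1 N ord0 i; apply.
exact: interval_open.
Qed.

Lemma measurable_mpeval p :
  measurable_fun setT (mpeval p : borel_rV R N -> R).
Proof.
have -> : mpeval p = (fun x : borel_rV R N =>
    \sum_(m <- msupp p) mcoeff m p * \prod_i x ord0 i ^+ m i).
  by apply/funext => x; rewrite /mpeval mevalE.
apply: measurable_sum => m; apply: measurable_funM; first exact: measurable_cst.
apply: measurable_prod => i _; apply: measurable_funX.
exact: measurable_coordinate.
Qed.

Lemma mpeval_le_unit_box p (x : 'rV[R]_N) : (forall i, `|x ord0 i| <= 1) ->
  `|mpeval p x| <= \sum_(m <- msupp p) `|mcoeff m p|.
Proof.
move=> x1; rewrite /mpeval mevalE; apply: le_trans (ler_norm_sum _ _ _) _.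
apply: ler_sum => m _; rewrite normrM ler_piMr// normr_prod.
apply: prodr_ile1 => i _; rewrite normrX; apply/andP; split.
  exact: exprn_ge0.
exact: exprn_ile1.
Qed.

(** The representing measure is the Dirac measure at [x]. *)
Lemma moment_cone_point X m (h : 'I_m -> {mpoly R[N]}) x :
  measurable (X : set (borel_rV R N)) -> X x ->
  moment_cone X h (\row_i mpeval (h i) x).
Proof.
move=> mX Xx; exists (dirac (x : borel_rV R N)).
  by rewrite /supported_on/= diracE memNset//= => /(_ Xx).
move=> i; rewrite integral_dirac//; last first.
  by apply/measurable_EFinP; exact: (measurable_funTS (measurable_mpeval (h i))).
by rewrite diracE mem_set// mul1e mxE.
Qed.

(** The inequality is integrated over [X]; polynomials are bounded on the unit box, so sum and
    integral commute. *)
Lemma moment_cone_ge0 X m (h : 'I_m -> {mpoly R[N]}) (y : 'rV[R]_m)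
    (c : 'I_m -> R) :
  measurable (X : set (borel_rV R N)) ->
  (forall x i, X x -> `|x ord0 i| <= 1) ->
  moment_cone X h y -> (forall x, X x -> 0 <= \sum_i c i * mpeval (h i) x) ->
  0 <= \sum_i c i * y ord0 i.
Proof.
move=> mX X1 [mu _ muy] c0.
have hint i : mu.-integrable X (fun x => (mpeval (h i) x)%:E).
  apply: measurable_bounded_integrable => //.
  - by rewrite ltey_eq fin_num_measure.
  - exact: (measurable_funTS (measurable_mpeval (h i))).
  - exists (\sum_(k <- msupp (h i)) `|mcoeff k (h i)|); split=> [|M hM x Xx].
      exact: num_real.
    by apply: le_trans (ltW hM); apply: mpeval_le_unit_box => j; exact: X1.
have : (0 <= \int[mu]_(x in X) \sum_i ((c i)%:E * (mpeval (h i) x)%:E))%E.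
  apply: integral_ge0 => x Xx; under eq_bigr do rewrite -EFinM.
  by rewrite sumEFin lee_fin; exact: c0.
rewrite integral_sum//; last by move=> i; exact: integrableZl.
under eq_bigr => i _ do rewrite integralZl// muy -EFinM.
by rewrite sumEFin lee_fin.
Qed.

(** The point [b + e *: (b - y)] is an affine combination with coefficients [1 + e] and [- e], and
    it tends to [b] as [e] decreases to 0. *)
Lemma relative_interior_beyond (V : normedModType R) (A : set V) (b y : V) :
  relative_interior A b -> A y ->
  exists2 e : R, 0 < e & A (b + e *: (b - y)).
Proof.
move=> [Ab bA] Ay.
have : \forall e \near 0^'+, A (b + e *: (b - y)).
  have cv : (fun e : R => b + e *: (b - y)) @ 0^'+ --> b.
    rewrite -[X in _ --> X]addr0 -(scale0r (b - y)).
    apply: cvg_at_right_filter; apply: cvgD; first exact: cvg_cst.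
    exact: scalel_continuous.
  have : \forall e \near 0^'+, affine_hull A (b + e *: (b - y)) ->
      A (b + e *: (b - y)) by exact: (cv _ bA).
  apply: filterS => e; apply.
  exists 2%N, (fun i : 'I_2 => if i == ord0 then 1 + e else - e),
    (fun i : 'I_2 => if i == ord0 then b else y); split.
  - by move=> i; case: ifP.
  - by rewrite !big_ord_recl big_ord0/=; ring.
  - rewrite !big_ord_recl big_ord0/= addr0 scalerDl scale1r scaleNr.
    by rewrite scalerBr addrA.
move=> H; near (0 : R)^'+ => e; exists e; first by [].
by near: e.
Unshelve. all: by end_near.
Qed.

End Moments.

(** * Compactness and continuity *)

Lemma box_compact (R : realType) (I : eqType) (lo hi : I -> R) :
  compact [set z : prod_topology (fun _ : I => R) |
           forall i, `[lo i, hi i]%classic (z i)].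
Proof.
apply: (@tychonoff I (fun=> R) (fun i => `[lo i, hi i]%classic)) => i.
exact: segment_compact.
Qed.

Lemma sum_continuous (R : realType) (T : topologicalType) (I : Type)
    (r : seq I) (f : I -> T -> R) : (forall i, continuous (f i)) ->
  continuous (fun z => \sum_(i <- r) f i z).
Proof.
move=> fc z; elim: r => [|i r IH].
  by under eq_fun do rewrite big_nil; exact: cst_continuous.
by under eq_fun do rewrite big_cons; apply: cvgD => //; exact: fc.
Qed.

Lemma lincomb_continuous (R : realType) (T : topologicalType) k
    (u : 'I_k -> T -> R) (c : 'I_k -> R) : (forall i, continuous (u i)) ->
  continuous (fun z => \sum_i u i z * c i).
Proof.
move=> uc; apply: sum_continuous => i z.
by apply: cvgM; [exact: uc|exact: cvg_cst].
Qed.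

Lemma gram_residual_continuous (R : realType) (T : topologicalType) m D
    (u : 'I_m -> T -> R) (w : 'I_D -> 'I_D -> T -> R) (a : R) (c : 'I_m -> R)
    (e : 'I_D -> R) :
  (forall i, continuous (u i)) -> (forall i j, continuous (w i j)) ->
  continuous (fun z =>
    a - \sum_i u i z * c i - \sum_i (\sum_j w i j z * e j) ^+ 2).
Proof.
move=> uc wc z; apply: cvgB.
  by apply: cvgB; [exact: cvg_cst|exact: lincomb_continuous].
apply: sum_continuous => i {}z; under eq_fun do rewrite expr2.
by apply: cvgM; apply: lincomb_continuous.
Qed.

(** * Attainment for programs over functions on a set *)

Section AttainedMaximum.
Context {R : realType} {T : Type} {m D : nat}.
Context (X : set T) (F : T -> R) (H : 'I_m -> T -> R) (G : 'I_D -> T -> R).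
Context (beta : 'I_m -> R).

(** Feasibility in terms of functions on [X]: no ideal part appears, and the number of squares is
    fixed. *)
Definition gram_feasible (lambda : 'I_m -> R) : Prop :=
  exists A : 'I_D -> 'I_D -> R, forall x, X x ->
    F x - \sum_i lambda i * H i x = \sum_i (\sum_j A i j * G j x) ^+ 2.

(* A feasible point is parametrised by the values of [\sum_i lambda i * H i] and
   of the [\sum_j A i j * G j] at finitely many points of [X]; these values are
   bounded on a superlevel set of the objective. *)
Lemma gram_maximum (lambda0 : 'I_m -> R) :
  (forall lambda lambda' : 'I_m -> R,
     (forall x, X x -> \sum_i lambda i * H i x = \sum_i lambda' i * H i x) ->
     \sum_i beta i * lambda i = \sum_i beta i * lambda' i) ->
  (forall x c, X x -> exists L, forall lambda : 'I_m -> R,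
     gram_feasible lambda -> c <= \sum_i beta i * lambda i ->
     L <= \sum_i lambda i * H i x) ->
  gram_feasible lambda0 ->
  exists2 lambda, gram_feasible lambda &
    forall lambda' : 'I_m -> R, gram_feasible lambda' ->
      \sum_i beta i * lambda' i <= \sum_i beta i * lambda i.
Proof.
move=> beta_ext low feas0.
have [k [p [P [pX PE]]]] := finite_interpolation X H.
have [k' [q [Q [qX QE]]]] := finite_interpolation X G.
pose c := \sum_i beta i * lambda0 i.
have {}low x : X x -> exists L, forall lambda : 'I_m -> R,
     gram_feasible lambda -> c <= \sum_i beta i * lambda i ->
     L <= \sum_i lambda i * H i x by move=> Xx; exact: low.
have /choice[Lp Lpv] j : exists L, forall lambda : 'I_m -> R,
     gram_feasible lambda -> c <= \sum_i beta i * lambda i ->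
     L <= \sum_i lambda i * H i (p j) by exact: low.
have /choice[Lq Lqv] j : exists L, forall lambda : 'I_m -> R,
     gram_feasible lambda -> c <= \sum_i beta i * lambda i ->
     L <= \sum_i lambda i * H i (q j) by exact: low.
(* One parameter for each value at [p j], and one for each pair of a square [a] and a point
   [q j]. *)
pose I : eqType := ('I_k + 'I_D * 'I_k')%type.
pose Z := prod_topology (fun _ : I => R).
pose lam (z : Z) i := \sum_j z (inl j) * P j i.
pose gram (z : Z) a b := \sum_j z (inr (a, j)) * Q j b.
(* Nonnegativity of the squares gives the upper bound [F]. A value [w] of a squared combination at
   [q j] has [w ^+ 2 <= M] with [M = F (q j) - Lq j], hence [|w| <= 1 + M]. *)
pose lo (i : I) : R := match i with
  | inl j => Lp j | inr (a, j) => - (1 + (F (q j) - Lq j)) end.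
pose hi (i : I) : R := match i with
  | inl j => F (p j) | inr (a, j) => 1 + (F (q j) - Lq j) end.
pose box : set Z := [set z : Z | forall i, `[lo i, hi i]%classic (z i)].
have box_co : compact box by exact: box_compact.
pose Phi x (z : Z) := F x - \sum_i lam z i * H i x -
  \sum_i (\sum_j gram z i j * G j x) ^+ 2.
have coord (i : I) : continuous (fun z : Z => z i).
  exact: (@proj_continuous I (fun=> R) i).
have lam_continuous i : continuous (fun z => lam z i).
  exact: (@lincomb_continuous R Z k (fun j z => z (inl j)) (fun j => P j i)).
have gram_continuous a b : continuous (fun z => gram z a b).
  exact: (@lincomb_continuous R Z k' (fun j z => z (inr (a, j))) (fun j => Q j b)).
have Phi_continuous x : continuous (Phi x).
  exact: (@gram_residual_continuous R Z m D (fun i z => lam z i)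
    (fun a b z => gram z a b) (F x) (fun i => H i x) (fun i => G i x)).
(* The vanishing of the residual at each point of [X] is a closed condition, so [S] is compact. *)
pose S := box `&` \bigcap_(x in X) (Phi x @^-1` [set 0]).
have S_compact : compact S.
  apply: compact_closedI => //; apply: closed_bigI => x _.
  by apply: preimage_closed; [move=> z _; exact: Phi_continuous|exact: closed_eq].
have feasP z : S z -> gram_feasible (lam z).
  move=> [_ Sz]; exists (gram z) => x /Sz /= /eqP.
  by rewrite /Phi subr_eq0 => /eqP.
(* Interpolation may change [lambda] but not its function on [X], and [beta_ext] then preserves the
   objective. *)
have surj lambda : gram_feasible lambda -> c <= \sum_i beta i * lambda i ->
    exists2 z, S z & \sum_i beta i * lam z i = \sum_i beta i * lambda i.
  move=> fl cl; have [A AE] := fl.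
  pose z : Z := fun i => match i with
    | inl j => \sum_i lambda i * H i (p j)
    | inr (a, j) => \sum_b A a b * G b (q j) end.
  have lamE x : X x -> \sum_i lam z i * H i x = \sum_i lambda i * H i x.
    exact: PE.
  have F_ge x : X x -> \sum_i lambda i * H i x <= F x.
    move=> Xx; rewrite -subr_ge0 AE//; apply: sumr_ge0 => a _; exact: sqr_ge0.
  exists z; last exact: beta_ext.
  split=> [[j|[a j]]|x Xx] /=.
  - by rewrite in_itv/= F_ge// andbT; exact: Lpv.
  - set w := \sum_b _; set M := F (q j) - Lq j.
    have wM : w ^+ 2 <= M.
      apply: (@le_trans _ _ (F (q j) - \sum_i lambda i * H i (q j))).
        rewrite AE// (bigD1 a)//= ler_wpDr//.
        by apply: sumr_ge0 => a' _; exact: sqr_ge0.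
      by rewrite lerB//; exact: Lqv.
    by rewrite in_itv/=; apply/andP; split; nra.
  - rewrite /Phi lamE// AE//; apply/eqP; rewrite subr_eq0; apply/eqP.
    by apply: eq_bigr => a _; rewrite (QE (A a)).
have [z0 Sz0 _] := surj _ feas0 (lexx _).
pose obj (z : Z) := \sum_i lam z i * beta i.
have objE z : obj z = \sum_i beta i * lam z i.
  by apply: eq_bigr => i _; rewrite mulrC.
have obj_continuous : continuous obj.
  exact: (@lincomb_continuous R Z m (fun i z => lam z i) beta).
have [z zS zmax] := compact_EVT_max (ex_intro _ z0 Sz0) S_compact
  (continuous_subspaceT obj_continuous).
exists (lam z); first by apply: feasP; exact: set_mem.
move=> lambda' fl'.
have cz : c <= obj z.
  have [z1 Sz1 z1E] := surj _ feas0 (lexx _); rewrite /c -z1E -objE.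
  exact/zmax/mem_set.
rewrite -objE.
(* A feasible point below the level [c] needs no parameter, since [z] already reaches [c]. *)
have [cl|cl] := leP c (\sum_i beta i * lambda' i); last first.
  exact: le_trans (ltW cl) cz.
by have [z' Sz' <-] := surj _ fl' cl; rewrite -objE; exact/zmax/mem_set.
Qed.

End AttainedMaximum.

(** * The truncated module as a Gram condition on the sphere product *)

Section SphereProduct.
Context {R : realType} {s : nat} {n : 'I_s -> nat}.
Context (n_gt0 : forall l, (0 < n l)%N).
Local Notation N := (\sum_(l < s) n l)%N.

Lemma measurable_sphere_product :
  measurable (sphere_product n : set (borel_rV R N)).
Proof.
have -> : sphere_product n = \bigcap_(l in [set: 'I_s])
    ((mpeval (sphere_poly n l) : borel_rV R N -> R) @^-1` [set 0]).
  apply/seteqP; split=> x.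
    move=> /sphere_productE xX l _ /=.
    by rewrite /mpeval meval_sphere_poly xX subrr.
  move=> xX; apply/sphere_productE => l; have /eqP := xX l I.
  by rewrite /mpeval meval_sphere_poly subr_eq0 => /eqP.
apply: fin_bigcap_measurable => // l _; rewrite -[X in measurable X]setTI.
exact: measurable_mpeval.
Qed.

Lemma sphere_product_le1 (x : 'rV[R]_N) i : sphere_product n x ->
  `|x ord0 i| <= 1.
Proof.
move=> /sphere_productE /(_ (tagnat.sig1 i)) xi.
rewrite -(@expr_le1 _ 2)// real_normK ?num_real// -xi.
rewrite (bigD1 (tagnat.sig2 i))//= tagnat.sig2K lerDl.
by apply: sumr_ge0 => j _; exact: sqr_ge0.
Qed.

Lemma mpeval_monomial_sum t (A : 'M[R]_(@nmonomials N t)) (x : 'rV[R]_N) :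
  mpeval (\sum_i (\sum_j A i j *: monomial j) ^+ 2) x =
  \sum_i (\sum_j A i j * mpeval (monomial j) x) ^+ 2.
Proof.
rewrite /mpeval raddf_sum/=; apply: eq_bigr => i _.
rewrite expr2 mevalM -expr2; congr (_ ^+ 2).
by rewrite raddf_sum/=; apply: eq_bigr => j _; rewrite mevalZ.
Qed.

(** Forward, the ideal part vanishes on the spheres. Backward, [p] minus the Gram sum vanishes there
    and has degree at most [2 * t], so [sphere_nullstellensatz] puts it in the truncated ideal. *)
Lemma sphere_truncated_module_gram t (p : {mpoly R[N]}) : (mpdeg p <= 2 * t)%N ->
  truncated_module (sphere_poly n) (2 * t) p <->
  exists A : 'M[R]_(@nmonomials N t), forall x, sphere_product n x ->
    mpeval p x = \sum_i (\sum_j A i j * mpeval (monomial j) x) ^+ 2.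
Proof.
move=> pt; split=> [[q /sos_le_gram[A qE] [r [k [_ rE]] <-]]|[A AE]].
  exists A => x /sphere_productE xX; rewrite -mpeval_monomial_sum -qE.
  have r0 : meval (x ord0) r = 0.
    rewrite rE raddf_sum/=; apply: big1 => l _.
    by rewrite mevalM meval_sphere_poly xX subrr mulr0.
  by rewrite /mpeval mevalD r0 addr0.
pose q : {mpoly R[N]} := \sum_i (\sum_j A i j *: monomial j) ^+ 2.
have qt : (mpdeg q <= 2 * t)%N.
  apply: mpdeg_sum_le => i _; rewrite expr2 mul2n -addnn.
  by apply: mpdegM_le; apply: mpdeg_sum_le => j _;
    exact/mpdegZ_le/mpdeg_monomial.
exists q.
  split=> //.
  exists [seq \sum_j A i j *: monomial j | i <- enum 'I_(@nmonomials N t)].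
  by rewrite big_map big_enum.
exists (p - q); last by rewrite addrC subrK.
apply: sphere_nullstellensatz => //.
  by apply: mpdegD_le => //; exact: mpdegN_le.
move=> x xX; rewrite /mpeval mevalB -!/(mpeval _ x) AE//.
by rewrite mpeval_monomial_sum subrr.
Qed.

End SphereProduct.

(** * Attainment for the semidefinite program *)

Theorem corollary6p1 (R : realType) (s : nat) (n : 'I_s -> nat)
  (s_ge1 : (1 <= s)%N) (n_ge2 : forall l, (2 <= n l)%N)
  (m : nat) (f : {mpoly R[\sum_(l < s) n l]})
  (h : 'I_m.+1 -> {mpoly R[\sum_(l < s) n l]}) (b : 'rV[R]_m.+1)
  (h1 : h ord0 = 1) (b1_gt0 : 0 < b ord0 ord0)
  (b_relint : relative_interior (moment_cone (sphere_product n) h) b)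
  (t : nat) (t_ge : (t_min f h <= t)%N) :
  exists2 lambda : 'rV[R]_m.+1,
    sdp_feasible (sphere_poly n) f h t lambda &
    (sdp_objective b lambda)%:E = sdp_value (sphere_poly n) f h b t.
Proof.
have n_gt0 l : (0 < n l)%N by exact: leq_trans (n_ge2 l).
have : (uphalf (mpdeg f) <= t)%N /\ forall i, (uphalf (mpdeg (h i)) <= t)%N.
  move: t_ge; rewrite /t_min !geq_max => /and3P[_ -> /bigmax_leqP ht].
  by split=> // i; exact: ht.
move=> [ft ht].
have {}ft : (mpdeg f <= 2 * t)%N by lia.
have {}ht i : (mpdeg (h i) <= 2 * t)%N by have := ht i; lia.
set X := sphere_product n in b_relint *.
have mX : measurable (X : set (borel_rV R _)) by exact: measurable_sphere_product.
have X1 x i : X x -> `|x ord0 i| <= 1 by exact: sphere_product_le1.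
pose H i x := mpeval (h i) x.
pose G j (x : 'rV[R]_(\sum_(l < s) n l)) := mpeval (@monomial R _ t j) x.
have bK : moment_cone X h b by case: b_relint.
pose row (lambda : 'I_m.+1 -> R) : 'rV[R]_m.+1 := \row_i lambda i.
have rowK (lambda : 'rV[R]_m.+1) : row (fun i => lambda ord0 i) = lambda.
  by apply/rowP => i; rewrite mxE.
have residualE lambda x :
    mpeval (f - \sum_i row lambda ord0 i *: h i) x =
    mpeval f x - \sum_i lambda i * H i x.
  rewrite /mpeval mevalB; congr (_ - _).
  rewrite (big_morph (meval (x ord0)) (mevalD (x ord0)) (meval0 (x ord0))).
  by apply: eq_bigr => i _; rewrite mevalZ mxE.
have feasE lambda : sdp_feasible (sphere_poly n) f h t (row lambda) <->
    gram_feasible X (mpeval f) H G lambda.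
  apply: (iff_trans (sphere_truncated_module_gram n_gt0 _)).
    apply: mpdegD_le => //; apply/mpdegN_le/mpdeg_sum_le => i _.
    exact: mpdegZ_le.
  split=> -[A AE].
    by exists A => x xX; rewrite -residualE AE.
  by exists (\matrix_(i, j) A i j) => x xX; rewrite residualE AE//;
    apply: eq_bigr => i _; congr (_ ^+ 2); apply: eq_bigr => j _; rewrite mxE.
have [c0 c0f] := sphere_module_order_unit ft.
(* As [h ord0 = 1], this choice makes the residual [f + c0]. *)
pose lambda0 (i : 'I_m.+1) := if i == ord0 then - c0 else 0.
have feas0 : gram_feasible X (mpeval f) H G lambda0.
  apply/feasE; rewrite /sdp_feasible/=.
  suff -> : f - \sum_i row lambda0 ord0 i *: h i = f + c0 *: 1 by [].
  rewrite /lambda0.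
  rewrite (bigD1 ord0)//= [X in _ - (_ + X)]big1 => [|i /negbTE i0]; last first.
    by rewrite mxE i0 scale0r.
  by rewrite mxE eqxx h1 addr0 scaleNr opprK.
have objE lambda : sdp_objective b (row lambda) = \sum_i b ord0 i * lambda i.
  by apply: eq_bigr => i _; rewrite mxE.
(* Pairing with a point of the moment cone is monotone in the function on [X]. *)
have b_le (l1 l2 : 'I_m.+1 -> R) :
    (forall x, X x -> \sum_i l1 i * H i x <= \sum_i l2 i * H i x) ->
    forall y, moment_cone X h y ->
    \sum_i l1 i * y ord0 i <= \sum_i l2 i * y ord0 i.
  move=> l12 y yK; rewrite -subr_ge0 -sumrB.
  under eq_bigr do rewrite -mulrBl.
  apply: (@moment_cone_ge0 _ _ X _ h) => // x Xx.
  by under eq_bigr do rewrite mulrBl; rewrite sumrB subr_ge0; exact: l12.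
have sum_ord0 (B : R) (a : 'I_m.+1 -> R) :
    \sum_i (if i == ord0 then B else 0) * a i = B * a ord0.
  by rewrite (bigD1 ord0)//= big1 ?addr0// => i /negbTE ->; rewrite mul0r.
have [||lambda lfeas lmax] := @gram_maximum R _ m.+1 _ X (mpeval f) H G
  (fun i => b ord0 i) _ _ _ feas0.
- move=> l1 l2 l12; under eq_bigr do rewrite mulrC.
  under [RHS]eq_bigr do rewrite mulrC.
  by apply/eqP; rewrite eq_le; apply/andP; split; apply: b_le => // x Xx;
    rewrite l12.
- move=> x c Xx.
  have [e e0 b'K] := relative_interior_beyond b_relint (moment_cone_point h mX Xx).
  set b' := b + _ in b'K.
  (* [B] bounds [f] on [X], hence also the combination of the [h i] at any feasible [l]; as a
     function it is [B] times [h ord0]. *)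
  pose B := \sum_(k <- msupp f) `|mcoeff k f|.
  (* Pairing [l] with [b'] gives [(1 + e)] times the objective, minus [e] times the value at [x], at
     most [B * b' ord0 ord0]; this is solved for the value, with the objective at least [c]. *)
  exists (((1 + e) * c - B * b' ord0 ord0) / e) => l [A AE] cl.
  have lb' : \sum_i l i * b' ord0 i <= B * b' ord0 ord0.
    have := b_le l (fun i => if i == ord0 then B else 0) _ b' b'K.
    rewrite sum_ord0; apply=> x' Xx'; rewrite sum_ord0.
    rewrite /H h1 /mpeval meval1 mulr1.
    apply: (@le_trans _ _ (mpeval f x')).
      rewrite -subr_ge0 AE//; apply: sumr_ge0 => i _; exact: sqr_ge0.
    apply: le_trans (ler_norm _) _; apply: mpeval_le_unit_box => i; exact: X1.
  have lb'E : \sum_i l i * b' ord0 i =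
      (1 + e) * (\sum_i b ord0 i * l i) - e * \sum_i l i * H i x.
    rewrite !mulr_sumr -sumrB; apply: eq_bigr => i _.
    by rewrite /b' !mxE -/(H i x); ring.
  rewrite ler_pdivrMr// mulrC.
  have : (1 + e) * c <= (1 + e) * \sum_i b ord0 i * l i.
    by rewrite ler_pM2l// addr_gt0.
  move: lb'; rewrite lb'E; lra.
exists (row lambda); first exact/feasE.
apply/eqP; rewrite eq_le; apply/andP; split.
  by apply: ereal_sup_ubound; exists (row lambda) => //; exact/feasE.
apply: ge_ereal_sup => _ [lambda' lfeas' <-]; rewrite lee_fin.
by rewrite -(rowK lambda') !objE; apply: lmax; apply/feasE; rewrite rowK.
Qed.
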